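(* (Strong soundness) For every set $\Pi \subseteq \mathcal{L}$ of formulas and every formula $\varphi \in \mathcal{L}$: if $\Pi \vdash \varphi$, then $\Pi \models \varphi$.
   Context: **Language.** Let $At$ be a countable set of atoms. The language $\mathcal{L}$ is given by $\varphi ::= p \mid \neg\varphi \mid \varphi\wedge\varphi \mid \mathcal{R}(\varphi) \mid \varphi \Rrightarrow \varphi$ with $p\in At$; other propositional connectives are defined as usual. Abbreviations: $\bot := \varphi_0\wedge\neg\varphi_0$ (for a fixed formula $\varphi_0$), $\top := \neg\bot$, $\Box\varphi := \top\Rrightarrow\varphi$, $\lozenge\varphi := \neg\Box\neg\varphi$. **Semantics.** A model is $\mathcal{M}=(X,\mathcal{T},v)$ where $X\neq\emptyset$ is a set, $\mathcal{T}$ is a topology on $X$, and $v:At\to\mathcal{P}(X)$. Let $\mathrm{int}(A)=\bigcup\{O\in\mathcal{T}: O\subseteq A\}$ and $||\varphi||^{\mathcal{M}}=\{s\in X:\mathcal{M},s\models\varphi\}$. Satisfaction at $s\in X$: $\mathcal{M},s\models p$ iff $s\in v(p)$; $\neg,\wedge$ are interpreted classically; $\mathcal{M},s\models\mathcal{R}\varphi$ iff $s\in\mathrm{int}(||\varphi||^{\mathcal{M}})$; $\mathcal{M},s\models\varphi\Rrightarrow\psi$ iff $\emptyset\neq\mathrm{int}(||\varphi||^{\mathcal{M}})\subseteq||\psi||^{\mathcal{M}}$. $\Pi\models\varphi$ means: for every model $\mathcal{M}$ and every state $s$ of $\mathcal{M}$, if $\mathcal{M},s\models\psi$ for all $\psi\in\Pi$,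 then $\mathcal{M},s\models\varphi$. **Proof system.** Axiom schemes: - (CL) all instances of classical propositional tautologies; - (K-R) $\mathcal{R}(\varphi\to\psi)\to(\mathcal{R}\varphi\to\mathcal{R}\psi)$; - (4) $\mathcal{R}\varphi\to\mathcal{R}\mathcal{R}\varphi$; - (K-RC) $(\varphi\Rrightarrow(\psi\to\chi))\to((\varphi\Rrightarrow\psi)\to(\varphi\Rrightarrow\chi))$; - (Abs) $\lozenge(\varphi\Rrightarrow\psi)\to\Box(\varphi\Rrightarrow\psi)$; - (RMP) $(\mathcal{R}\varphi\wedge(\varphi\Rrightarrow\psi))\to\psi$; - (Dis) $(\varphi\Rrightarrow\psi)\to(\varphi\Rrightarrow\mathcal{R}\psi)$; - (Mon) $\lozenge\mathcal{R}(\varphi\wedge\chi)\to((\varphi\Rrightarrow\psi)\to((\varphi\wedge\chi)\Rrightarrow\psi))$; - (NV) $(\varphi\Rrightarrow\psi)\to\lozenge\mathcal{R}\varphi$. Rules: (MP) from $\varphi$ and $\varphi\to\psi$ infer $\psi$; (RCI) from $\varphi\to\psi$ infer $\lozenge\mathcal{R}\varphi\to(\varphi\Rrightarrow\psi)$; (N$_{\mathcal{R}}$) from $\varphi$ infer $\mathcal{R}\varphi$. A derivation of $\varphi_n$ is a finite sequence $\varphi_1,\dots,\varphi_n$ in which each formula is an axiom instance or follows from earlier ones by a rule; $\vdash\varphi$ means a derivation of $\varphi$ exists. $\Gamma\vdash\varphi$ means that $\vdash\varphi$ or $\vdash(\psi_1\wedge\dots\wedge\psi_n)\to\varphi$ for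 some $\psi_1,\dots,\psi_n\in\Gamma$. *)

(* Defs.v *)
From HB Require Import structures.
From mathcomp Require Import all_boot.
From mathcomp Require Import boolp classical_sets topology.

Set Implicit Arguments.
Unset Strict Implicit.
Unset Printing Implicit Defensive.

Local Open Scope classical_set_scope.

Inductive formula (At : Type) : Type :=
| Atom of At
| Neg of formula At
| And of formula At & formula At
| Rob of formula At
| Cond of formula At & formula At.

Lemma formula_eq_dec (At : eqType) : comparable (formula At).
Proof. move=> x y; rewrite /decidable; decide equality; exact: eq_comparable. Defined.

HB.instance Definition _ (At : eqType) :=
  hasDecEq.Build (formula At) (compareP (@formula_eq_dec At)).

Declare Scope formula_scope.
Delimit Scope formula_scope with F.
Bind Scope formula_scope with formula.

Notation "¬ a" := (Neg a) (at level 35, right associativity) : formula_scope.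
Notation "a ∧ b" := (And a b) (at level 40, left associativity) : formula_scope.
Notation "'ℛ' a" := (Rob a) (at level 35, right associativity) : formula_scope.
Notation "a ⇛ b" := (Cond a b) (at level 45, no associativity) : formula_scope.

Definition Imp (At : Type) (a b : formula At) : formula At := (¬ (a ∧ ¬ b))%F.
Notation "a → b" := (Imp a b)
  (at level 50, b at level 50, right associativity) : formula_scope.

(* The abbreviations depend on the formula [f0] fixed to express falsity. *)
Definition Bot (At : Type) (f0 : formula At) : formula At := (f0 ∧ ¬ f0)%F.
Definition Top (At : Type) (f0 : formula At) : formula At := (¬ Bot f0)%F.
Definition Box (At : Type) (f0 a : formula At) : formula At := (Top f0 ⇛ a)%F.
Definition Dia (At : Type) (f0 a : formula At) : formula At :=
  (¬ Box f0 (¬ a))%F.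

(* The choice structure that [topologicalType] requires of the carrier is no
   restriction classically: every type has one. *)
Record model (At : Type) := Model {
  carrier :> topologicalType;
  carrier_nonempty : [set: carrier] !=set0;
  valuation : At -> set carrier }.

Fixpoint sat (At : Type) (M : model At) (f : formula At) (s : M) : Prop :=
  match f with
  | Atom p => valuation p s
  | Neg a => ~ sat a s
  | And a b => sat a s /\ sat b s
  | Rob a => [set t : M | sat a t]° s
  | Cond a b => [set t : M | sat a t]° !=set0 /\
                [set t : M | sat a t]° `<=` [set t : M | sat b t]
  end.

Definition entails (At : Type) (P : set (formula At)) (f : formula At) : Prop :=
  forall (M : model At) (s : M), (forall g, P g -> sat g s) -> sat f s.

(* Classical propositional formulas, used as schemata: a tautology instance is
   obtained by substituting formulas for the propositional variables. *)
Inductive pform : Type :=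
| PVar of nat
| PNeg of pform
| PAnd of pform & pform.

Fixpoint peval (e : nat -> bool) (p : pform) : bool :=
  match p with
  | PVar n => e n
  | PNeg a => ~~ peval e a
  | PAnd a b => peval e a && peval e b
  end.

Definition tautology (p : pform) : Prop := forall e, peval e p.

Fixpoint psubst (At : Type) (sg : nat -> formula At) (p : pform) : formula At :=
  match p with
  | PVar n => sg n
  | PNeg a => ¬ psubst sg a
  | PAnd a b => psubst sg a ∧ psubst sg b
  end%F.

Inductive axiom (At : Type) (f0 : formula At) : formula At -> Prop :=
| Ax_CL sg p : tautology p -> axiom f0 (psubst sg p)
| Ax_KR a b : axiom f0 (ℛ (a → b) → (ℛ a → ℛ b))
| Ax_4 a : axiom f0 (ℛ a → ℛ ℛ a)
| Ax_KRC a b c : axiom f0 ((a ⇛ (b → c)) → ((a ⇛ b) → (a ⇛ c)))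
| Ax_Abs a b : axiom f0 (Dia f0 (a ⇛ b) → Box f0 (a ⇛ b))
| Ax_RMP a b : axiom f0 ((ℛ a ∧ (a ⇛ b)) → b)
| Ax_Dis a b : axiom f0 ((a ⇛ b) → (a ⇛ ℛ b))
| Ax_Mon a b c :
    axiom f0 (Dia f0 (ℛ (a ∧ c)) → ((a ⇛ b) → ((a ∧ c) ⇛ b)))
| Ax_NV a b : axiom f0 ((a ⇛ b) → Dia f0 (ℛ a)).

(* [f] is an axiom instance or follows by a rule from formulas in [prev]. *)
Inductive justified (At : eqType) (f0 : formula At) (prev : seq (formula At)) :
  formula At -> Prop :=
| J_Ax a : axiom f0 a -> justified f0 prev a
| J_MP a b : a \in prev -> (a → b)%F \in prev -> justified f0 prev b
| J_RCI a b : (a → b)%F \in prev ->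
    justified f0 prev (Dia f0 (ℛ a) → (a ⇛ b))
| J_NR a : a \in prev -> justified f0 prev (ℛ a).

Definition derivation (At : eqType) (f0 : formula At) (d : seq (formula At)) :
  Prop := forall d1 f d2, d = d1 ++ f :: d2 -> justified f0 d1 f.

Definition derivable (At : eqType) (f0 f : formula At) : Prop :=
  exists d, derivation f0 (rcons d f).

(* Finite conjunctions of premises are nonempty and associate to the left. *)
Definition derives (At : eqType) (f0 : formula At) (P : set (formula At))
    (f : formula At) : Prop :=
  derivable f0 f \/
  exists (g : formula At) (gs : seq (formula At)),
    (forall h, h \in g :: gs -> P h) /\
    derivable f0 (foldl (@And At) g gs → f).

(* Main.v *)
(* The truth value of [a ⇛ b] does not depend on the state, so [Box] and [Dia]
   quantify universally and existentially over all states; under this reading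
   every axiom and rule is an elementary property of the interior operator. *)

Require Import Defs.
From mathcomp Require Import all_boot.
From mathcomp Require Import classical_sets.
From mathcomp Require Import boolp topology.

Local Open Scope classical_set_scope.

Definition valid {At : Type} (f : formula At) : Prop :=
  forall (M : model At) (s : M), sat f s.

Section Satisfaction.
Context {At : Type} {M : model At}.
Implicit Types (a b : formula At) (s : M).

Lemma sat_imp a b s : sat (a → b)%F s <-> (sat a s -> sat b s).
Proof.
split=> /= [nab sa | ab [sa nb]]; last exact: nb (ab sa).
by apply: contrapT => nb; apply: nab.
Qed.

Lemma sat_top f0 s : sat (Top f0) s.
Proof. by move=> /= -[]. Qed.

(** The truth set of [Top f0] is the whole space, which is its own interior; the non-emptiness
    clause of [⇛] is then exactly [carrier_nonempty]. *)
Lemma sat_box f0 a s : sat (Box f0 a) s <-> forall t : M, sat a t.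
Proof.
have topE : [set t : M | sat (Top f0) t] = setT.
  by apply/seteqP; split=> // t _; exact: sat_top.
rewrite /Box; cbn [sat]; rewrite topE interiorT.
split=> [[_ Ta] t | Ta]; first exact: Ta.
by split=> [|t _]; [exact: carrier_nonempty | exact: Ta].
Qed.

Lemma sat_dia f0 a s : sat (Dia f0 a) s <-> exists t : M, sat a t.
Proof.
rewrite /Dia; cbn [sat]; split=> [nb | [t ta] /sat_box na]; last exact: na ta.
by apply: contrapT => /forallNP na; apply/nb/sat_box.
Qed.

(** At a fixed state, classical truth of the substituted formulas is a Boolean valuation, so
    tautologies can be evaluated there. *)
Lemma sat_psubst (sg : nat -> formula At) p s :
  sat (psubst sg p) s <-> peval (fun n => `[< sat (sg n) s >]) p.
Proof.
elim: p => [n|a IHa|a IHa b IHb] /=; first by rewrite asboolE.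
- by rewrite IHa; split=> /negP.
- by rewrite IHa IHb; split=> /andP.
Qed.

End Satisfaction.

Lemma sat_foldl_and {At : eqType} {M : model At} (g : formula At) gs (s : M) :
  {in g :: gs, forall h, sat h s} -> sat (foldl (@And At) g gs) s.
Proof.
elim: gs g => [|h gs IH] g sgs; first by apply: sgs; rewrite mem_head.
apply: IH => k; rewrite inE => /orP[/eqP ->|kgs]; last first.
  by apply: sgs; rewrite !inE kgs !orbT.
by split; apply: sgs; rewrite !inE eqxx ?orbT.
Qed.

Lemma axiom_valid {At : Type} (f0 f : formula At) : Defs.axiom f0 f -> valid f.
Proof.
case=> {f} [sg p taut|a b|a|a b c|a b|a b|a b|a b c|a b] M s.
- by apply/sat_psubst; exact: taut.
(* [ℛ a] at [s] says that the truth set of [a] is a neighbourhood of [s], and neighbourhoods form a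
   filter. *)
- apply/sat_imp => Rab; apply/sat_imp; apply: filterS2 Rab.
  by move=> t /sat_imp.
- by apply/sat_imp => Ra; apply: open_nbhs_nbhs; split; first exact: open_interior.
- apply/sat_imp => -[ne abc]; apply/sat_imp => -[_ ab]; split=> // t at'.
  by move/sat_imp: (abc t at'); apply; exact: ab.
(* The fact [tab] at [t] is, by conversion, the same proposition at every state. *)
- by apply/sat_imp => /sat_dia[t tab]; apply/sat_box.
- by apply/sat_imp => -[Ra [_ ab]]; exact: ab.
- apply/sat_imp => -[ne ab]; split=> //.
  (* An open set included in a set is included in its interior. *)
  by rewrite open_subsetE in ab; last exact: open_interior.
- apply/sat_imp => /sat_dia[t Rac]; apply/sat_imp => -[_ ab].
  split; first by exists t.
  by apply: subset_trans ab; apply: interiorS => u [].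
- by apply/sat_imp => -[[t Ra] _]; apply/sat_dia; exists t.
Qed.

(** The invariant is validity, not truth at one state: RCI and the rule for [ℛ] use their premise at
    states other than the current one. *)
Lemma justified_valid {At : eqType} (f0 : formula At) prev f :
  {in prev, forall g, valid g} -> justified f0 prev f -> valid f.
Proof.
move=> vprev; case=> {f} [a /axiom_valid //|a b pa pab|a b pab|a pa] M s.
- have va := vprev _ pa; have vab := vprev _ pab.
  by have /sat_imp := vab M s; apply; exact: va.
- have vab := vprev _ pab; apply/sat_imp => /sat_dia[t Ra]; split; first by exists t.
  move=> u /interior_subset ua.
  by have /sat_imp := vab M u; apply.
- by apply: filterE => t; exact: vprev pa M t.
Qed.

Lemma derivation_valid {At : eqType} (f0 : formula At) d :
  derivation f0 d -> {in d, forall g, valid g}.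
Proof.
elim/last_ind: d => // d f IH der.
have vd : {in d, forall g, valid g}.
  (* A prefix of a derivation is a derivation, since each entry is justified by what precedes it. *)
  by apply: IH => d1 g d2 dE; apply: (der _ _ (rcons d2 f)); rewrite dE rcons_cat.
have jf : justified f0 d f by apply: (der _ _ [::]); rewrite cats1.
move=> g; rewrite mem_rcons inE => /orP[/eqP ->|/vd //].
exact: justified_valid jf.
Qed.

Lemma derivable_valid {At : eqType} (f0 f : formula At) :
  derivable f0 f -> valid f.
Proof. by case=> d /derivation_valid; apply; rewrite mem_rcons mem_head. Qed.

Theorem theorem5p12 (At : countType) (f0 : formula At)
    (P : set (formula At)) (f : formula At) :
  derives f0 P f -> entails P f.
Proof.
case=> [/derivable_valid vf M s _ | [g [gs [gsP /derivable_valid vf]]] M s sP].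
  exact: vf.
(* Premises enter only here, at the single state [s], through an implication that is already
   valid. *)
have /sat_imp := vf M s; apply; apply: sat_foldl_and => h /gsP.
exact: sP.
Qed.
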